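(* Let $\mathcal{X}\subseteq\mathbb{R}^d$ be nonempty, closed and convex, and let $V:\mathbb{R}^d\to\mathbb{R}^d$ be $\beta$-Lipschitz continuous and $\alpha$-strongly monotone ($\alpha,\beta>0$). Suppose that the variational inequality ''find $x^\star\in\mathcal{X}$ with $\langle V(x^\star),x-x^\star\rangle\ge0$ for all $x\in\mathcal{X}$'' has a solution, and let $x^\star$ be its (necessarily unique) solution. Assume that the Past Extra-Gradient algorithm (PEG) of the context is run with stochastic oracle feedback and step-sizes $\gamma_t=\gamma/(t+b)$ for some $\gamma>1/\alpha$ and $b\ge 4\beta\gamma$. Then the base states satisfy, as $t\to\infty$, $$\mathbb{E}\big[\|X_t-x^\star\|^2\big]\le\frac{6\gamma^2\sigma^2}{\alpha\gamma-1}\,\frac1t+o\!\left(\frac1t\right),$$ and the ergodic average $\bar X_t=t^{-1}\sum_{s=1}^{t}X_s$ satisfies $$\mathbb{E}\big[\|\bar X_t-x^\star\|^2\big]\le\frac{6\gamma^2\sigma^2}{\alpha\gamma-1}\,\frac{\log t}{t}+o\!\left(\frac{\log t}{t}\right).$$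
   Context: $\|\cdot\|$ is the Euclidean norm and $\Pi_{\mathcal{X}}$ the Euclidean projection onto $\mathcal{X}$. $V$ is $\beta$-Lipschitz if $\|V(x')-V(x)\|\le\beta\|x'-x\|$, and $\alpha$-strongly monotone if $\langle V(x')-V(x),x'-x\rangle\ge\alpha\|x'-x\|^2$, for all $x,x'\in\mathbb{R}^d$. (PEG): starting from (possibly random, square-integrable) $X_{1/2},X_1\in\mathcal{X}$, for $t=1,2,\dots$, $$X_{t+1/2}=\Pi_{\mathcal{X}}(X_t-\gamma_tV_{t-1/2}),\qquad X_{t+1}=\Pi_{\mathcal{X}}(X_t-\gamma_tV_{t+1/2}).$$ Stochastic oracle: for $t=0,1,2,\dots$, $V_{t+1/2}=V(X_{t+1/2})+Z_{t+1/2}$, where the noise satisfies $\mathbb{E}[Z_{t+1/2}\mid\mathcal{F}_{t+1/2}]=0$ and $\mathbb{E}[\|Z_{t+1/2}\|^2\mid\mathcal{F}_{t+1/2}]\le\sigma^2$ for some $\sigma\ge0$. Here $\mathcal{F}_{t+1/2}$ is the history of the process up to the generation of $X_{t+1/2}$, before $Z_{t+1/2}$ is drawn: it is generated by $X_{1/2},X_1$ and the oracle outputs $V_{1/2},\dots,V_{t-1/2}$. In particular $X_{t+1/2}$ is $\mathcal{F}_{t+1/2}$-measurable, and for $t\ge1$ one also writes $\mathcal{F}_t=\mathcal{F}_{t+1/2}$. *)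

(* Defs.v *)
From HB Require Import structures.
From mathcomp Require Import all_boot all_order all_algebra.
From mathcomp Require Import all_classical all_reals all_analysis.

Set Implicit Arguments.
Unset Strict Implicit.
Unset Printing Implicit Defensive.

Import Order.TTheory GRing.Theory Num.Theory.
Import numFieldNormedType.Exports.

Local Open Scope classical_set_scope.
Local Open Scope ring_scope.

Section Euclidean.
Context {R : realType} {n : nat}.
Implicit Types (u v x y p q : 'rV[R]_n) (K : set 'rV[R]_n)
  (V : 'rV[R]_n -> 'rV[R]_n) (alpha beta : R).

Definition dotp u v : R := \sum_(i < n) u 0 i * v 0 i.

(* The library norm `|u| on 'rV[R]_n is the sup norm, hence a separate
   Euclidean norm. Both induce the same topology, so the library's [closed]
   is closedness in the usual topology of R^n. *)
Definition enorm u : R := Num.sqrt (dotp u u).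

Definition elipschitz beta V :=
  forall x x', enorm (V x' - V x) <= beta * enorm (x' - x).

Definition strongly_monotone alpha V :=
  forall x x', alpha * enorm (x' - x) ^+ 2 <= dotp (V x' - V x) (x' - x).

Definition vi_solution K V x :=
  K x /\ forall y, K y -> 0 <= dotp (V x) (y - x).

(* [xget] returns a point of the given set, which is a singleton when K is
   nonempty, closed and convex; 0 is the default for an empty set. *)
Definition eproj K y : 'rV[R]_n :=
  xget 0 [set p | K p /\ forall q, K q -> enorm (y - p) <= enorm (y - q)].

(* Half-integer indices are shifted: xh t is x_{t+1/2} and vh t is v_{t+1/2};
   thus vh t.-1 is v_{t-1/2}. The sequence x starts at index 1: the value x 0
   is unconstrained and never used. *)
Definition peg_run K (gam : nat -> R) (x xh vh : nat -> 'rV[R]_n) :=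
  forall t, (1 <= t)%N ->
    xh t = eproj K (x t - gam t *: vh t.-1) /\
    x t.+1 = eproj K (x t - gam t *: vh t).

End Euclidean.

Section Stochastic.
Context {disp : measure_display} {T : measurableType disp} {R : realType}.
Implicit Types (P : probability T R) (F : set (set T)) (f g : T -> R).

(* g is a version of the conditional expectation of f given the
   sub-sigma-algebra F. *)
Definition is_cond_exp P F f g :=
  [/\ P.-integrable setT (EFin \o f),
      P.-integrable setT (EFin \o g),
      g_sigma_algebra_preimage g `<=` F &
      forall A, F A ->
        (\int[P]_(w in A) (f w)%:E = \int[P]_(w in A) (g w)%:E)%E].

Context {n : nat}.

Definition random_vector (X : T -> 'rV[R]_n) :=
  forall i, measurable_fun setT (fun w => X w 0 i).

Definition square_integrable P (X : T -> 'rV[R]_n) :=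
  random_vector X /\ ('E_P[fun w => (enorm (X w) ^+ 2)%R] < +oo)%E.

(* F_{t+1/2}, the sigma-algebra generated by X_{1/2}, X_1 and
   V_{1/2}, ..., V_{t-1/2}, with Xh, Vh indexed as in [peg_run]. *)
Definition history (X Xh Vh : nat -> T -> 'rV[R]_n) (t : nat) : set (set T) :=
  <<s [set A | exists i : 'I_n,
        [\/ g_sigma_algebra_preimage (fun w => Xh 0%N w 0 i) A,
            g_sigma_algebra_preimage (fun w => X 1%N w 0 i) A |
            exists2 s, (s < t)%N &
              g_sigma_algebra_preimage (fun w => Vh s w 0 i) A]] >>.

(* Conditional expectations of vectors are taken coordinatewise. *)
Definition stochastic_oracle P (sigma : R) (V : 'rV[R]_n -> 'rV[R]_n)
    (X Xh Vh Z : nat -> T -> 'rV[R]_n) :=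
  forall t,
    [/\ random_vector (Z t),
        forall w, Vh t w = V (Xh t w) + Z t w,
        forall i,
          is_cond_exp P (history X Xh Vh t) (fun w => Z t w 0 i) (cst 0) &
        exists2 g : T -> R,
          is_cond_exp P (history X Xh Vh t) (fun w => enorm (Z t w) ^+ 2) g &
          {ae P, forall w, g w <= sigma ^+ 2}].

(* The average over s = 1, ..., t. *)
Definition ergodic_average (X : nat -> T -> 'rV[R]_n) (t : nat) (w : T) :=
  t%:R^-1 *: \sum_(1 <= s < t.+1) X s w.

End Stochastic.

(* Main.v *)
Require Import Defs.
From HB Require Import structures.
From mathcomp Require Import all_boot all_order all_algebra.
From mathcomp Require Import all_classical all_reals all_analysis.
From mathcomp Require Import finmap ring lra measurable_realfun.

Import Order.TTheory GRing.Theory Num.Theory.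
Import numFieldNormedType.Exports.

Local Open Scope classical_set_scope.
Local Open Scope ring_scope.

Set Implicit Arguments.
Unset Strict Implicit.
Unset Printing Implicit Defensive.

(** Write s_t = t + b, g_t = gamma / s_t, D_t = |X_t - x*|^2,
    m_t = |X_{t+1/2} - X_t|^2 and delta_t = |V_{t+1/2} - V_{t-1/2}|^2.

    The variational characterisation of the two projections made at time t
    gives, for every realisation of the noise,
      D_{t+1} <= D_t - 2 g_t <V_{t+1/2}, X_{t+1/2} - x*> + g_t^2 delta_t - m_t
    ([extragradient_step]). Strong monotonicity and the optimality of x* bound
    <V(X_{t+1/2}), X_{t+1/2} - x*> below by alpha |X_{t+1/2} - x*|^2, hence by
    alpha (D_t / 2 - m_t). The Lipschitz condition and the nonexpansiveness of
    the projection bound delta_t by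
      6 beta^2 m_t + 6 beta^2 g_{t-1}^2 delta_{t-1}
        + 3 |Z_{t+1/2}|^2 + 3 |Z_{t-1/2}|^2.
    Therefore the Lyapunov function L_t = D_t + g_{t-1}^3 delta_{t-1} satisfies,
    as soon as g_t is small,
      L_{t+1} <= (1 - alpha g_t) L_t - 2 g_t <Z_{t+1/2}, X_{t+1/2} - x*>
        + 3 (g_t^2 + g_t^3) (|Z_{t+1/2}|^2 + |Z_{t-1/2}|^2)
    ([pointwise_descent]). The cubic weight of delta is what makes its cost of
    lower order, so that the constant 6 is not spoiled.

    All the iterates are square integrable and X_{t+1/2} is measurable with
    respect to the history, so that the inner product with the noise has mean
    zero ([pull_out], [noise_orthogonal]). With q = alpha gamma > 1, this leaves
      E L_{t+1} <= (1 - q / s_t) E L_t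
        + 6 gamma^2 sigma^2 / s_t^2 + 6 gamma^3 sigma^2 / s_t^3
    ([mean_descent]). A version of Chung's lemma ([chung]) turns this into
    E L_t <= (C + o(1)) / t: the function C / s + M / (s (1 + ln s)) is a
    supersolution of the recursion when M and s are large.

    For the ergodic average, convexity of the squared norm gives
    E |mean of X_s - x*|^2 <= t^-1 sum_{s <= t} E D_s, and the sum of
    (C + o(1)) / s over s <= t is (C + o(1)) ln t ([ergodic_sum]). *)

(** * Euclidean geometry of row vectors *)

Section geometry.
Context {R : realType} {n : nat}.
Implicit Types (u v x y p q : 'rV[R]_n) (K : set 'rV[R]_n) (a b : R).

Lemma dotpC u v : dotp u v = dotp v u.
Proof. by apply: eq_bigr => i _; rewrite mulrC. Qed.

Lemma dotpDl u v x : dotp (u + v) x = dotp u x + dotp v x.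
Proof. by rewrite -big_split; apply: eq_bigr => i _; rewrite mxE mulrDl. Qed.

Lemma dotpZl a u v : dotp (a *: u) v = a * dotp u v.
Proof. by rewrite mulr_sumr; apply: eq_bigr => i _; rewrite mxE mulrA. Qed.

Lemma dotpNl u v : dotp (- u) v = - dotp u v.
Proof. by rewrite -scaleN1r dotpZl mulN1r. Qed.

Lemma dotpDr u v x : dotp u (v + x) = dotp u v + dotp u x.
Proof. by rewrite dotpC dotpDl !(dotpC u). Qed.

Lemma dotpZr a u v : dotp u (a *: v) = a * dotp u v.
Proof. by rewrite dotpC dotpZl (dotpC u). Qed.

Lemma dotpNr u v : dotp u (- v) = - dotp u v.
Proof. by rewrite dotpC dotpNl (dotpC u). Qed.

Definition dotpE := (dotpDl, dotpDr, dotpNl, dotpNr, dotpZl, dotpZr).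

Lemma dotp_sqrD u v a : dotp (u + a *: v) (u + a *: v) =
  dotp u u + 2 * a * dotp u v + a ^+ 2 * dotp v v.
Proof. by rewrite !dotpE (dotpC v u); ring. Qed.

Lemma dotp_ge0 u : 0 <= dotp u u.
Proof. by apply: sumr_ge0 => i _; rewrite -expr2 sqr_ge0. Qed.

Lemma enorm_sqr u : enorm u ^+ 2 = dotp u u.
Proof. by rewrite sqr_sqrtr ?dotp_ge0. Qed.

Lemma ler_enorm u v : (enorm u <= enorm v) = (dotp u u <= dotp v v).
Proof. by rewrite ler_sqrt ?dotp_ge0. Qed.

Lemma normr_coord_le_enorm u i : `|u 0 i| <= enorm u.
Proof.
rewrite -sqrtr_sqr ler_sqrt ?dotp_ge0// /dotp (bigD1 i)//= -expr2 lerDl.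
by apply: sumr_ge0 => j _; rewrite -expr2 sqr_ge0.
Qed.

Lemma continuous_enormB y : continuous (fun q => enorm (y - q)).
Proof.
have cd : continuous (fun q : 'rV[R]_n => dotp (y - q) (y - q)).
  apply: continuous_big => [|i _ x]; first exact: add_continuous.
  have ci : (y - q) 0 i @[q --> x] --> (y - x) 0 i.
    under eq_fun do rewrite !mxE; rewrite !mxE.
    apply: (@cvgB _ R^o _ (nbhs x) _ (fun=> y 0 i) (fun q => q 0 i)).
      exact: cvg_cst.
    exact: coord_continuous.
  exact: (cvgM ci ci).
move=> x; apply: (@continuous_comp _ _ _ (fun q => dotp (y - q) (y - q)) Num.sqrt).
  exact: cd.
exact: (@sqrt_continuous R (dotp (y - x) (y - x))).
Qed.

Lemma dense_rat_vector x (e : R) : 0 < e ->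
  exists q : 'rV[rat]_n, enorm (x - map_mx ratr q) < e.
Proof.
move=> e0; have [dl dl0 edl] : exists2 dl : R, 0 < dl & e = n.+1%:R * dl.
  by exists (e / n.+1%:R); [rewrite divr_gt0|rewrite mulrC divfK].
have /choice[q hq] : forall i : 'I_n, exists r : rat, `|x 0 i - ratr r| < dl.
  move=> i; have lt1 : x 0 i - dl < x 0 i + dl by lra.
  have [r] := rat_in_itvoo lt1.
  by rewrite in_itv/= => /andP[h1 h2]; exists r; rewrite ltr_norml; lra.
exists (\row_i q i).
rewrite -(@ltr_pXn2r _ 2)// ?nnegrE ?sqrtr_ge0 ?(ltW e0)// enorm_sqr.
apply: (@le_lt_trans _ _ (\sum_(i < n) dl ^+ 2)).
  apply: ler_sum => i _; rewrite !mxE -expr2 -real_normK ?num_real//.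
  by rewrite lerXn2r ?nnegrE ?(ltW dl0)// ltW.
rewrite sumr_const card_ord.
rewrite edl exprMn -[X in X < _]mulr_natl ltr_pM2r ?exprn_gt0// -natrX ltr_nat.
by rewrite expnS expn1 mulSn ltn_addr.
Qed.

Lemma dotp_sumr I (r : seq I) (F : I -> 'rV[R]_n) u :
  dotp u (\sum_(i <- r) F i) = \sum_(i <- r) dotp u (F i).
Proof.
elim: r => [|i r IH]; last by rewrite !big_cons dotpDr IH.
by rewrite !big_nil; apply: big1 => j _; rewrite mxE mulr0.
Qed.

Lemma dotp_le2D u v : dotp (u + v) (u + v) <= 2 * dotp u u + 2 * dotp v v.
Proof. by have := dotp_ge0 (u - v); rewrite !dotpE (dotpC v u); lra. Qed.

Lemma dotp_le2B u v : dotp (u - v) (u - v) <= 2 * dotp u u + 2 * dotp v v.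
Proof. by have := dotp_ge0 (u + v); rewrite !dotpE (dotpC v u); lra. Qed.

Lemma dotp_le3 u v x :
  dotp (u + v - x) (u + v - x) <= 3 * dotp u u + 3 * dotp v v + 3 * dotp x x.
Proof.
have := dotp_ge0 (u - v); have := dotp_ge0 (u + x); have := dotp_ge0 (v + x).
by rewrite !dotpE (dotpC v u) (dotpC x u) (dotpC x v); lra.
Qed.

(** Jensen's inequality for the squared norm, in the form
    0 <= sum_s |X_s - mean|^2. *)
Lemma enorm_ergodic_average d (T : measurableType d)
    (X : nat -> T -> 'rV[R]_n) t w x : (0 < t)%N ->
  enorm (ergodic_average X t w - x) ^+ 2 <=
  t%:R^-1 * \sum_(1 <= s < t.+1) enorm (X s w - x) ^+ 2.
Proof.
move=> t0; have t0' : 0 < t%:R :> R by rewrite ltr0n.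
rewrite enorm_sqr /ergodic_average; set m := _ - x.
have mE : t%:R *: m = \sum_(1 <= s < t.+1) (X s w - x).
  rewrite /m scalerBr scalerA divff ?gt_eqF// scale1r sumrB.
  by rewrite sumr_const_nat subn1 scaler_nat.
have : 0 <= \sum_(1 <= s < t.+1) dotp (X s w - x - m) (X s w - x - m).
  by apply: sumr_ge0 => s _; exact: dotp_ge0.
have -> : \sum_(1 <= s < t.+1) dotp (X s w - x - m) (X s w - x - m) =
    \sum_(1 <= s < t.+1) enorm (X s w - x) ^+ 2 - t%:R * dotp m m.
  have -> : t%:R * dotp m m = 2 * dotp m (t%:R *: m) - t%:R * dotp m m.
    by rewrite dotpZr; ring.
  rewrite mE dotp_sumr mulr_sumr.
  have -> : t%:R * dotp m m = \sum_(1 <= s < t.+1) dotp m m.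
    by rewrite sumr_const_nat subn1 mulr_natl.
  rewrite -!sumrB; apply: eq_bigr => s _; rewrite enorm_sqr.
  by rewrite -[in LHS](scaleN1r m) dotp_sqrD (dotpC m); ring.
by rewrite subr_ge0 mulrC -ler_pdivlMr// mulrC.
Qed.

(** A Lipschitz function f is the infimum over a countable dense set of points q
    of the functions f q + L |x - q|; hence {f o X < c} is a countable union of
    measurable sets, although only the coordinates of X are measurable. *)
Lemma measurable_lipschitz_comp d (T : measurableType d) (f : 'rV[R]_n -> R)
    (L : R) (X : T -> 'rV[R]_n) :
  (forall x y, `|f x - f y| <= L * enorm (x - y)) ->
  (forall i, measurable_fun setT (fun w => X w 0 i)) ->
  measurable_fun setT (fun w => f (X w)).
Proof.
move=> fL mX.
have mN (q : 'rV[R]_n) : measurable_fun setT (fun w => enorm (X w - q)).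
  apply: (@measurableT_comp _ _ _ _ R R Num.sqrt _ (fun w => dotp (X w - q) (X w - q))).
    exact: continuous_measurable_fun (@sqrt_continuous R).
  apply: measurable_sum => i; apply: measurable_funM.
    under eq_fun do rewrite !mxE; exact: measurable_funD.
  under eq_fun do rewrite !mxE; exact: measurable_funD.
move=> mT; apply: (measurability _ (RGenInftyO.measurableE R)) => //.
move=> /= _ [_ [c ->] <-]; rewrite setTI.
rewrite [X in measurable X](_ : _ = \bigcup_(q : 'rV[rat]_n)
   [set w | f (map_mx ratr q) + L * enorm (X w - map_mx ratr q) < c]).
  apply: countable_bigcupT_measurable => [|q]; first exact: countableP.
  rewrite -[X in measurable X]setTI.
  have mg : measurable_fun setT (fun w => f (map_mx ratr q)
      + L * enorm (X w - map_mx ratr q)).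
    by apply: measurable_funD => //; apply: measurable_funM.
  have := mg measurableT `]-oo, c[%classic (measurable_itv _).
  by congr (measurable (_ `&` _)); apply/seteqP; split => w /=; rewrite in_itv.
apply/seteqP; split => w /=; rewrite in_itv/=; last first.
  move=> [q _ /=]; apply: le_lt_trans.
  by rewrite -lerBlDl; apply: le_trans (fL _ _); exact: ler_norm.
move=> fc; have e0 : 0 < (c - f (X w)) / (2 * (`|L| + 1)).
  by rewrite divr_gt0 ?subr_gt0// mulr_gt0// ltr_wpDl.
have [q hq] := dense_rat_vector (X w) e0.
exists q => //=.
have h1 : f (map_mx ratr q) - f (X w) <= L * enorm (X w - map_mx ratr q).
  by apply: le_trans (fL _ _); rewrite distrC; exact: ler_norm.
rewrite ltr_pdivlMr in hq; last by rewrite mulr_gt0// ltr_wpDl.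
have h2 : L * enorm (X w - map_mx ratr q) <= (`|L| + 1) * enorm (X w - map_mx ratr q).
  by rewrite ler_wpM2r ?sqrtr_ge0//; have := ler_norm L; lra.
lra.
Qed.

(** The distance to y attains its minimum over K on the compact set of points of
    K that are no further from y than a given one. *)
Lemma exists_proj K y : K !=set0 -> closed K ->
  exists p, K p /\ forall q, K q -> enorm (y - p) <= enorm (y - q).
Proof.
move=> [k0 Kk0] Kcl; pose A := K `&` [set q | enorm (y - q) <= enorm (y - k0)].
have cN : continuous (fun q => enorm (y - q)).
  exact: continuous_enormB.
have A0 : A !=set0 by exists k0; split => //=.
have Ac : compact A.
  apply: bounded_closed_compact.
    exists (`|y| + enorm (y - k0)); split; first exact: num_real.
    move=> M hM q [_ /= hq]; apply: le_trans (ltW hM).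
    rewrite -[q](subKr y); apply: (le_trans (ler_normB _ _)).
    rewrite lerD2l; apply: le_trans hq.
    rewrite [X in X <= _]mx_normrE; apply: bigmax_le => [|[i j] _ /=]; first exact: sqrtr_ge0.
    by rewrite ord1; exact: normr_coord_le_enorm.
  apply: closedI => //.
  have := @preimage_closed _ _ (fun q => enorm (y - q)) [set r | r <= enorm (y - k0)].
  by apply; [move=> q _; exact: cN|exact: closed_le].
have [p pA hp] := compact_EVT_min A0 Ac (continuous_subspaceT cN).
have [Kp hp0] := set_mem pA.
exists p; split=> // q Kq; have [hq|hq] := leP (enorm (y - q)) (enorm (y - k0)).
  by apply: hp; apply: mem_set; split.
exact: le_trans hp0 (ltW hq).
Qed.

Lemma convex_combination K p q (t : R) : @convex_set R 'rV[R]_n K ->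
  K p -> K q -> 0 <= t <= 1 -> K (p + t *: (q - p)).
Proof.
move=> Kc Kp Kq /andP[t0 t1].
have /set_mem := Kc q p (Itv01 t0 t1) (mem_set Kq) (mem_set Kp).
congr K; apply/rowP => i; by rewrite !mxE /= /unstable.onem; ring.
Qed.

(** [two_projections_descent] written with u = x - x', h = xh - x', e = p - x',
    z = v' and y = v' - v; the square |g y - h|^2 absorbs the cross term. *)
Lemma two_projections_arith g (u h e z y : 'rV[R]_n) :
  dotp (u - g *: z) e <= 0 -> dotp (u - h - g *: (z - y)) h >= 0 ->
  dotp e e <= dotp (u - e) (u - e) - 2 * g * dotp z (h - e)
    + g ^+ 2 * dotp y y - dotp (h - u) (h - u).
Proof.
move=> h1 h2; have h3 := dotp_ge0 (g *: y - h).
rewrite !dotpE in h1; rewrite !dotpE in h2; rewrite !dotpE (dotpC h y) in h3.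
rewrite !dotpE (dotpC e u) (dotpC h u).
move: (dotp u e) (dotp u u) (dotp u h) (dotp e e) (dotp h h) (dotp z e) (dotp z h)
  (dotp y h) (dotp y y) h1 h2 h3 => *.
lra.
Qed.

(** If x' and xh satisfy the variational inequalities of the projections of
    x - g v' and x - g v, tested at p and at x' respectively, then x' is closer
    to p than x, up to the error terms of the extra-gradient method. *)
Lemma two_projections_descent x p xh x' v v' g :
  dotp (x - g *: v' - x') (p - x') <= 0 -> dotp (x - g *: v - xh) (x' - xh) <= 0 ->
  dotp (x' - p) (x' - p) <= dotp (x - p) (x - p) - 2 * g * dotp v' (xh - p)
     + g ^+ 2 * dotp (v' - v) (v' - v) - dotp (xh - x) (xh - x).
Proof.
move=> h1 h2.
have {}h1 : dotp (x - x' - g *: v') (p - x') <= 0 by rewrite addrAC.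
have {}h2 : 0 <= dotp (x - x' - (xh - x') - g *: (v' - (v' - v))) (xh - x').
  have -> : x - x' - (xh - x') - g *: (v' - (v' - v)) = x - g *: v - xh.
    by apply/rowP => i; rewrite !mxE; ring.
  by rewrite -oppr_le0 -dotpNr opprB.
have := two_projections_arith h1 h2.
have -> : x - x' - (p - x') = x - p by apply/rowP => i; rewrite !mxE; ring.
have -> : xh - x' - (p - x') = xh - p by apply/rowP => i; rewrite !mxE; ring.
have -> : xh - x' - (x - x') = xh - x by apply/rowP => i; rewrite !mxE; ring.
by rewrite -(opprB p x') dotpNl dotpNr opprK.
Qed.

Section projection.
Variable K : set 'rV[R]_n.
Hypotheses (K0 : K !=set0) (Kcl : closed K) (Kcv : @convex_set R 'rV[R]_n K).

Lemma eproj_spec y : K (eproj K y) /\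
  forall q, K q -> enorm (y - eproj K y) <= enorm (y - q).
Proof.
apply: (@xgetPex _ _
  (fun p => K p /\ forall q, K q -> enorm (y - p) <= enorm (y - q))).
exact: exists_proj.
Qed.

Lemma eproj_in y : K (eproj K y).
Proof. exact: (eproj_spec y).1. Qed.

(** The variational characterisation of the projection. *)
Lemma eproj_vi y q : K q -> dotp (y - eproj K y) (q - eproj K y) <= 0.
Proof.
have [Kp hp] := eproj_spec y; set p := eproj K y in Kp hp * => Kq.
rewrite leNgt; apply/negP => c0.
(* If the product c were positive, the point p + t (q - p) with
   t = c / (c + |q - p|^2) would be closer to y than p. *)
set c := dotp _ _ in c0; pose a := dotp (q - p) (q - p).
have a0 : 0 <= a by exact: dotp_ge0.
pose t := c / (c + a).
have ca0 : 0 < c + a by exact: ltr_wpDr.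
have t0 : 0 < t by exact: divr_gt0.
have t1 : t <= 1 by rewrite ler_pdivrMr// mul1r lerDl.
have := hp _ (convex_combination Kcv Kp Kq (_ : 0 <= t <= 1)).
rewrite (ltW t0) t1 => /(_ isT); rewrite ler_enorm.
have -> : y - (p + t *: (q - p)) = (y - p) + (- t) *: (q - p).
  by rewrite scaleNr opprD addrA.
rewrite dotp_sqrD -/c -/a.
have tca : t * (c + a) = c by rewrite /t divfK// gt_eqF.
suff : t * (2 * c - t * a) > 0 by nra.
by rewrite mulr_gt0//; nra.
Qed.

(** The projection is firmly nonexpansive. *)
Lemma eproj_firm y z : dotp (eproj K y - eproj K z) (eproj K y - eproj K z) <=
  dotp (y - z) (eproj K y - eproj K z).
Proof.
have := eproj_vi z (eproj_in y); have := eproj_vi y (eproj_in z).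
move: (eproj K y) (eproj K z) => p q.
rewrite -[X in X <= 0]opprK -dotpNr opprB -[X in _ -> X <= 0 -> _]opprK.
by rewrite !dotpE (dotpC q p); lra.
Qed.

Lemma eproj_nonexpansive y z : dotp (eproj K y - eproj K z) (eproj K y - eproj K z) <=
  dotp (y - z) (y - z).
Proof.
have le_dotp u v : dotp v v <= dotp u v -> dotp v v <= dotp u u.
  by have := dotp_ge0 (u - v); rewrite !dotpE (dotpC v u); lra.
exact/le_dotp/eproj_firm.
Qed.

Lemma extragradient_step x v v' p g : K p ->
  let xh := eproj K (x - g *: v) in let x' := eproj K (x - g *: v') in
  dotp (x' - p) (x' - p) <= dotp (x - p) (x - p) - 2 * g * dotp v' (xh - p)
     + g ^+ 2 * dotp (v' - v) (v' - v) - dotp (xh - x) (xh - x).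
Proof.
move=> Kp; apply: two_projections_descent; first exact: eproj_vi.
by apply: eproj_vi; exact: eproj_in.
Qed.

End projection.
End geometry.

(** * Pulling a measurable factor out of a conditional expectation *)

Section pull_out.
Context {d : measure_display} {T : measurableType d} {R : realType}.
Variables (P : probability T R) (G : set (set T)).
Hypothesis Gm : G `<=` measurable.

Let sGm : <<s G >> `<=` (@measurable d T).
Proof. by apply: smallest_sub => //; exact: sigma_algebra_measurable. Qed.

Lemma sub_measurable_fun (Y : T -> R) :
  @measurable_fun _ _ (g_sigma_algebraType G) R setT Y -> measurable_fun setT Y.
Proof.
move=> mY _ B mB; apply: sGm.
exact: (mY measurableT B mB).
Qed.

Import HBNNSimple.

Variable Z : T -> R.
Hypothesis iZ : P.-integrable setT (EFin \o Z).
Hypothesis Z0 : forall A, <<s G >> A -> (\int[P]_(w in A) (Z w)%:E = 0)%E.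

(** The hypothesis [Z0] says that Z has conditional expectation zero given the
    sigma-algebra generated by [G]. *)
Lemma sfun_pull_out (h : {nnsfun (g_sigma_algebraType G) >-> R}) :
  (\int[P]_w (h w * Z w)%:E = 0)%E.
Proof.
have mh (y : R) : <<s G >> ((h : T -> R) @^-1` [set y]).
  have := @measurable_funP _ _ _ _ setT h measurableT [set y] (measurable_set1 y).
  by rewrite setTI.
transitivity (\int[P]_w (\sum_(y <- fset_set (range h))
    (y%:E * (EFin \o Z) \_ (h @^-1` [set y]) w)))%E.
  apply: eq_integral => w _.
  rewrite [in LHS](@fimfunE _ _ h) fsbig_finite//= big_distrl/= -sumEFin.
  apply: eq_bigr => y _.
  by rewrite -mulrA EFinM patchE indicE; case: ifPn => _; rewrite ?mul1r ?mul0r.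
have iy y : P.-integrable setT ((EFin \o Z) \_ (h @^-1` [set y])).
  apply: (integrable_mkcond _ (sGm (mh y))).1.
  by apply: (integrableS measurableT _ _ iZ) => //; exact: (sGm (mh y)).
rewrite integral_sum //=; last by move=> y; exact: integrableZl.
apply: big1 => y _; rewrite integralZl//.
by rewrite -integral_mkcond (Z0 (mh y)) mule0.
Qed.

(** Dominated convergence along an increasing sequence of simple functions. *)
Lemma ge0_pull_out (Y : T -> R) : (forall w, 0 <= Y w) ->
  @measurable_fun _ _ (g_sigma_algebraType G) R setT Y ->
  P.-integrable setT (EFin \o (fun w => Y w * Z w)) ->
  (\int[P]_w (Y w * Z w)%:E = 0)%E.
Proof.
move=> Y0 mY iYZ.
have mYE := (measurable_EFinP setT (Y : g_sigma_algebraType G -> R)).2 mY.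
pose h := nnsfun_approx (@measurableT _ (g_sigma_algebraType G)) mYE.
have mZ : measurable_fun setT Z by have /measurable_int/measurable_EFinP := iZ.
have hcv (w : T) : EFin \o h^~ w @ \oo --> (Y w)%:E.
  by apply: (cvg_nnsfun_approx _ mYE) => // x _; rewrite lee_fin.
have hle n (w : T) : h n w <= Y w.
  have hc : h^~ w @ \oo --> Y w by exact: (fine_cvg (hcv w)).
  rewrite -(cvg_lim (@Rhausdorff R) hc); apply: nondecreasing_cvgn_le.
    move=> k l kl.
    have /lefP := nd_nnsfun_approx
      (@measurableT _ (g_sigma_algebraType G)) mYE kl.
    exact.
  by apply/cvg_ex; exists (Y w).
have mh n : measurable_fun setT (h n : T -> R).
  by apply: sub_measurable_fun; exact: measurable_funP.
have mhZ n : measurable_fun setT (fun w : T => (h n w * Z w)%:E).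
  by apply/measurable_EFinP; exact: (measurable_funM (mh n) mZ).
have hZcv (w : T) : (fun n => (h n w * Z w)%:E) @ \oo --> (Y w * Z w)%:E.
  under eq_fun do rewrite EFinM.
  rewrite EFinM; exact: (cvgeZr _ (hcv w)).
have hZle (w : T) n : (`|(h n w * Z w)%:E| <= `|(Y w * Z w)%:E|)%E.
  by rewrite /= lee_fin !normrM ler_wpM2r ?normr_ge0// !ger0_norm.
have [_ _] := @dominated_convergence _ T R P setT measurableT
  (fun n w => (h n w * Z w)%:E) (fun w => (Y w * Z w)%:E)
  (abse \o (fun w => (Y w * Z w)%:E)) mhZ (measurable_int _ iYZ)
  (aeW _ (fun w _ => hZcv w)) (integrable_abse iYZ)
  (aeW _ (fun w n _ => hZle w n)).
have -> : [sequence (\int[P]_w (h n w * Z w)%:E)%E]_n = fun=> 0%E.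
  by apply/funext => n; exact: (sfun_pull_out (h n)).
by move=> /(cvg_lim (@ereal_hausdorff R)) <-; rewrite lim_cst.
Qed.

(** If Z has conditional expectation zero, then Y Z has mean zero for every Y
    measurable with respect to the conditioning sigma-algebra. *)
Lemma pull_out (Y : T -> R) :
  @measurable_fun _ _ (g_sigma_algebraType G) R setT Y ->
  P.-integrable setT (EFin \o (fun w => Y w * Z w)) ->
  (\int[P]_w (Y w * Z w)%:E = 0)%E.
Proof.
move=> mY iYZ.
have mYT := sub_measurable_fun mY.
have mZ : measurable_fun setT Z by have /measurable_int/measurable_EFinP := iZ.
have mp : @measurable_fun _ _ (g_sigma_algebraType G) R setT (Y^\+).
  exact: (@measurable_funrpos _ (g_sigma_algebraType G)).
have mn : @measurable_fun _ _ (g_sigma_algebraType G) R setT (Y^\-).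
  exact: (@measurable_funrneg _ (g_sigma_algebraType G)).
have ip : P.-integrable setT (EFin \o (fun w => Y^\+ w * Z w)).
  apply: le_integrable iYZ => //.
    by apply/measurable_EFinP; exact: (measurable_funM (sub_measurable_fun mp) mZ).
  move=> w _; rewrite /= lee_fin !normrM ler_wpM2r// /funrpos ger0_norm ?le_max ?lexx ?orbT//.
  by rewrite ge_max ler_norm normr_ge0.
have im : P.-integrable setT (EFin \o (fun w => Y^\- w * Z w)).
  apply: le_integrable iYZ => //.
    by apply/measurable_EFinP; exact: (measurable_funM (sub_measurable_fun mn) mZ).
  move=> w _; rewrite /= lee_fin !normrM ler_wpM2r// /funrneg ger0_norm ?le_max ?lexx ?orbT//.
  by rewrite ge_max -normrN ler_norm normr_ge0.
have YE w : Y w * Z w = Y^\+ w * Z w - Y^\- w * Z w.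
  rewrite -mulrBl /funrpos /funrneg; congr (_ * _).
  case: (leP 0 (Y w)) => Yw.
    by rewrite (@max_r _ _ (- Y w)) ?oppr_le0// subr0.
  by rewrite (@max_l _ _ (- Y w)) ?oppr_ge0 1?ltW// sub0r opprK.
under eq_integral do rewrite YE EFinB.
rewrite integralB//= !ge0_pull_out// ?sube0//.
Qed.
End pull_out.

(** * Real sequences *)

Section asymptotics.
Context {R : realType}.
Implicit Types (a b c e q s x y A B C M : R).

Lemma ln_natS_lower t : (0 < t)%N -> (t.+1)%:R^-1 <= ln (t.+1)%:R - ln t%:R :> R.
Proof.
move=> t0; have t0' : 0 < t%:R :> R by rewrite ltr0n.
rewrite -opprB -ln_div ?posrE ?ltr0n// lerNr.
have -> : t%:R / t.+1%:R = 1 + - t.+1%:R^-1 :> R.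
  by rewrite -natr1; field; rewrite natr1 pnatr_eq0.
by apply: le_ln1Dx; rewrite ltrN2 invf_lt1 ?ltr0n// ltr1n.
Qed.

Lemma ln_succ_le s : 0 < s -> ln (s + 1) <= ln s + s^-1.
Proof.
move=> s0; have -> : s + 1 = s * (1 + s^-1) by rewrite mulrDr mulr1 divff ?gt_eqF.
have v0 : 0 < s^-1 by rewrite invr_gt0.
rewrite lnM ?posrE ?addr_gt0// lerD2l; apply: le_ln1Dx.
by apply: lt_trans v0; rewrite ltrN10.
Qed.

Lemma ln_nat_unbounded M : exists N : nat, forall t, (N <= t)%N -> M <= ln t%:R.
Proof.
exists (Num.truncn (expR M)).+1 => t Nt.
have ht : expR M < t%:R by apply: lt_le_trans (truncnS_gt _) _; rewrite ler_nat.
by rewrite -ler_expR lnK ?posrE ?(lt_trans (expR_gt0 M))// ltW.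
Qed.

(** Applied with l = 1 + ln s and l' = 1 + ln (s + 1): the ratio of the values of
    1 / (s (1 + ln s)) at s + 1 and at s is at least 1 - 1 / s - 1 / (s l). *)
Lemma inv_mul_log_step s (l l' : R) : 1 <= s -> 1 <= l -> 0 < l' -> l' <= l + s^-1 ->
  (s * l)^-1 * (1 - s^-1 - (s * l)^-1) <= ((s + 1) * l')^-1.
Proof.
move=> s1 l1 l'0 hl.
have s0 : 0 < s by lra.
have l0 : 0 < l by lra.
have sl0 : 0 < s * l by rewrite mulr_gt0.
apply: (@le_trans _ _ (((s + 1) * (l + s^-1))^-1)); last first.
  by rewrite lef_pV2 ?posrE ?mulr_gt0 ?addr_gt0 ?invr_gt0// ler_pM2l//; lra.
have -> : (s + 1) * (l + s^-1) = (s * l) * ((1 + s^-1) * (1 + (s * l)^-1)).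
  by field; rewrite !gt_eqF.
rewrite [leRHS]invfM ler_pM2l ?invr_gt0//.
set x := s^-1; set y := (s * l)^-1.
have x0 : 0 < x by rewrite invr_gt0.
have y0 : 0 < y by rewrite invr_gt0.
have d0 : 0 < (1 + x) * (1 + y) by rewrite mulr_gt0 ?addr_gt0.
rewrite -[leRHS]mul1r ler_pdivlMr//.
have xy0 : 0 < x * y by rewrite mulr_gt0.
nra.
Qed.

(** With l = 1 + ln s and l' = 1 + ln (s + 1): the function 1 / (s (1 + ln s)) is
    a supersolution of the recursion with a source term of order s^-3, as soon
    as ln s is large. *)
Lemma log_supersolution q s (l l' : R) : 1 < q -> 1 <= s -> 1 <= l -> l <= s ->
  2 / (q - 1) <= l -> 0 < l' -> l' <= l + s^-1 ->
  (1 - q / s) * (s * l)^-1 + (q - 1) / 2 / s ^+ 3 <= ((s + 1) * l')^-1.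
Proof.
move=> q1 s1 l1 ls ql l'0 hl; apply: le_trans (inv_mul_log_step s1 l1 l'0 hl).
have s0 : 0 < s by lra.
have l0 : 0 < l by lra.
have q0 : 0 < q - 1 by lra.
have hil : l^-1 <= (q - 1) / 2.
  by rewrite -[leRHS]invrK lef_pV2 ?posrE ?invr_gt0 ?divr_gt0// invf_div.
set d := q - 1 in q0 hil *.
have -> : 1 - q / s = 1 - s^-1 - d / s by rewrite /d; field; rewrite gt_eqF.
have -> : (s * l)^-1 = s^-1 * l^-1 by rewrite invfM.
have -> : d / 2 / s ^+ 3 = d / 2 * s^-1 ^+ 3 by rewrite exprVn.
have hsl : s^-1 <= l^-1 by rewrite lef_pV2 ?posrE.
have x0 : 0 < s^-1 by rewrite invr_gt0.
set x := s^-1 in hsl x0 *; set y := l^-1 in hil hsl *.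
have y0 : 0 < y by lra.
have H1 : d / 2 * x ^+ 2 * (y - x) >= 0 by rewrite !mulr_ge0// ?subr_ge0// ?exprn_ge0; lra.
have H2 : x ^+ 2 * y * (d / 2 - y) >= 0 by rewrite !mulr_ge0// ?subr_ge0// ?exprn_ge0; lra.
rewrite -subr_ge0.
have -> : x * y * (1 - x - x * y) - ((1 - x - d * x) * (x * y) + d / 2 * x ^+ 3)
  = d / 2 * x ^+ 2 * (y - x) + x ^+ 2 * y * (d / 2 - y) by field.
exact: addr_ge0.
Qed.

(** The function 1 / s is a supersolution with source term (q - 1) / s^2. *)
Lemma inv_supersolution q s : 1 < q -> 0 < s ->
  (1 - q / s) * s^-1 + (q - 1) / s ^+ 2 <= (s + 1)^-1.
Proof.
move=> q1 s0; rewrite -subr_ge0.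
have -> : (s + 1)^-1 - ((1 - q / s) * s^-1 + (q - 1) / s ^+ 2) = (s ^+ 2 * (s + 1))^-1.
  by field; rewrite !gt_eqF//; lra.
by rewrite invr_ge0 mulr_ge0 ?exprn_ge0//; lra.
Qed.

(** Chung's lemma, with a source term of lower order and its sharp constant. *)
Lemma chung (L : nat -> R) q b A B (T0 : nat) :
  1 < q -> 0 <= b -> 0 <= A -> 0 <= B ->
  (forall t, (T0 <= t)%N -> L t.+1 <= (1 - q / (t%:R + b)) * L t
      + A / (t%:R + b) ^+ 2 + B / (t%:R + b) ^+ 3) ->
  forall e, 0 < e -> exists N, forall t, (N <= t)%N -> L t <= (A / (q - 1) + e) / t%:R.
Proof.
move=> q1 b0 A0 B0 HL e e0.
set c := A / (q - 1).
have q0 : 0 < q - 1 by lra.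
have c0 : 0 <= c by rewrite divr_ge0// ltW.
have [N1 hN1] := ln_nat_unbounded (2 / (q - 1)).
have hq : q < (Num.bound q)%:R by apply: archi_boundP; lra.
(* From T1 on, the factor 1 - q / s is nonnegative and ln s >= 2 / (q - 1). *)
pose T1 := (maxn (maxn T0 N1) (maxn (Num.bound q) 1)).
pose sh (t : nat) := t%:R + b.
pose l (t : nat) := 1 + ln (sh t).
have shS t : sh t.+1 = sh t + 1 by rewrite /sh -natr1; ring.
have sh1 t : (0 < t)%N -> 1 <= sh t.
  by move=> t0; rewrite /sh ler_wpDr// ler1n.
have l1 t : (0 < t)%N -> 1 <= l t by move=> /sh1 st; rewrite /l lerDl ln_ge0.
have ls t : (0 < t)%N -> l t <= sh t.
  move=> /sh1 st; rewrite /l -lerBrDl.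
  have := @le_ln1Dx _ (sh t - 1); rewrite (addrC 1) subrK; apply; lra.
have lnl t : (0 < t)%N -> ln t%:R <= l t.
  move=> t0; apply: (@le_trans _ _ (ln (sh t))); last by rewrite lerDr.
  by rewrite ler_ln ?posrE ?ltr0n ?(lt_le_trans ltr01 (sh1 t t0))// lerDl.
have T1P t : (T1 <= t)%N -> [/\ (T0 <= t)%N, (N1 <= t)%N, (Num.bound q <= t)%N & (0 < t)%N].
  by rewrite !geq_max => /andP[/andP[-> ->] /andP[-> ->]].
have [_ _ _ T1p] := T1P _ (leqnn T1).
pose W t := (sh t * l t)^-1.
have W0 t : (0 < t)%N -> 0 < W t.
  by move=> t0; rewrite invr_gt0 mulr_gt0//; [have := sh1 _ t0|have := l1 _ t0]; lra.
(* The first term makes the supersolution exceed L at time T1, the second one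
   absorbs the source term of order s^-3. *)
pose M := Num.max (L T1 / W T1) (2 * B / (q - 1)).
have M0 : 0 <= M by rewrite le_max; apply/orP; right; rewrite divr_ge0 ?mulr_ge0// ltW.
have MB : B <= M * ((q - 1) / 2).
  have : 2 * B / (q - 1) <= M by rewrite le_max lexx orbT.
  by rewrite ler_pdivrMr// => h; lra.
have LU t : (T1 <= t)%N -> L t <= c / sh t + M * W t.
  elim: t => [|t IH].
    by rewrite leqn0 => /eqP T10; move: T1p; rewrite T10.
  rewrite leq_eqVlt => /orP[/eqP <-|].
    apply: (@le_trans _ _ (M * W T1)).
      by rewrite -ler_pdivrMr ?W0// le_max lexx.
    by rewrite lerDr divr_ge0// (le_trans ler01)// sh1.
  rewrite ltnS => Tt; have {}IH := IH Tt; have [tT0 tN1 tq t0] := T1P _ Tt.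
  have := HL _ tT0; rewrite -/(sh t) => /le_trans; apply.
  have s1 := sh1 _ t0.
  have s0 : 0 < sh t by lra.
  have qs : 0 <= 1 - q / sh t.
    rewrite subr_ge0 ler_pdivrMr// mul1r /sh.
    apply: (le_trans (ltW hq)); apply: ler_wpDr => //; by rewrite ler_nat.
  have h1 := ler_wpM2l qs IH.
  have h2 := inv_supersolution q1 s0; rewrite -shS in h2.
  have h3 : (1 - q / sh t) * W t + (q - 1) / 2 / sh t ^+ 3 <= W t.+1.
    rewrite /W shS; apply: log_supersolution => //.
    - exact: l1.
    - exact: ls.
    - exact: le_trans (hN1 _ tN1) (lnl _ t0).
    - by apply: lt_le_trans (l1 t.+1 _).
    - by rewrite /l shS; have := ln_succ_le s0; lra.
  have h2' := ler_wpM2l c0 h2; have h3' := ler_wpM2l M0 h3.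
  have i3 : 0 <= (sh t ^+ 3)^-1 by rewrite invr_ge0 exprn_ge0// ltW.
  have hB := ler_wpM2r i3 MB.
  have hA : c * ((q - 1) / sh t ^+ 2) = A / sh t ^+ 2 by rewrite /c mulrA divfK// gt_eqF.
  rewrite mulrDr hA in h2'.
  rewrite -mulrA mulrDr in h3'.
  move: h1 h2' h3' hB; rewrite mulrDr.
  rewrite -(mulrA M).
  set x1 := _ * L t; set x2 := _ / _ ^+ 2; set x3 := B / _.
  have -> : (1 - q / sh t) * (c / sh t) = c * ((1 - q / sh t) * (sh t)^-1) by ring.
  have -> : (1 - q / sh t) * (M * W t) = M * ((1 - q / sh t) * W t) by ring.
  lra.
have [N3 hN3] := ln_nat_unbounded (M / e).
exists (maxn T1 N3) => t; rewrite geq_max => /andP[tT1 tN3].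
have [_ _ _ t0] := T1P _ tT1.
have t0' : 0 < t%:R :> R by rewrite ltr0n.
have s0 : 0 < sh t by apply: lt_le_trans (sh1 _ t0).
have l0 : 0 < l t by apply: lt_le_trans (l1 _ t0).
apply: (le_trans (LU _ tT1)).
apply: (@le_trans _ _ ((c + e) / sh t)).
  have hM : M / l t <= e.
    rewrite ler_pdivrMr// mulrC -ler_pdivrMr//.
    exact: le_trans (hN3 _ tN3) (lnl _ t0).
  have -> : M * W t = (M / l t) / sh t by rewrite /W invfM; ring.
  by rewrite mulrDl lerD2l ler_pM2r ?invr_gt0.
rewrite ler_wpM2l ?addr_ge0 ?(ltW e0)//.
by rewrite lef_pV2 ?posrE// lerDl.
Qed.

(** A sequence below (C + o(1)) / t has Cesaro means below
    (C + o(1)) ln t / t. *)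
Lemma ergodic_sum (D : nat -> R) C : 0 <= C ->
  (forall e, 0 < e -> exists N, forall t, (N <= t)%N -> D t <= (C + e) / t%:R) ->
  forall e, 0 < e -> exists N, forall t, (N <= t)%N ->
    t%:R^-1 * (\sum_(1 <= s < t.+1) D s) <= (C + e) * (ln t%:R / t%:R).
Proof.
move=> C0 HD e e0; have e20 : 0 < e / 2 by rewrite divr_gt0.
have [N0 hN0] := HD _ e20.
pose N := maxn N0 1.
have Np : (0 < N)%N by rewrite leq_max orbT.
pose S := \sum_(1 <= s < N.+1) D s.
have hs t : (N <= t)%N -> \sum_(1 <= s < t.+1) D s <= S + (C + e / 2) * ln t%:R.
  elim: t => [|t IH]; first by rewrite leqn0 => /eqP N0'; move: Np; rewrite N0'.
  rewrite leq_eqVlt => /orP[/eqP <-|].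
    by rewrite lerDl mulr_ge0 ?addr_ge0 ?(ltW e20)// ln_ge0// ler1n.
  rewrite ltnS => Nt; rewrite big_nat_recr//=.
  have t0 : (0 < t)%N by apply: leq_trans Nt.
  have h1 := IH Nt.
  have h2 : D t.+1 <= (C + e / 2) / t.+1%:R.
    by apply: hN0; rewrite (leq_trans _ (leqW Nt))// leq_max leqnn.
  have h3 := ln_natS_lower t0.
  have Ce : 0 <= C + e / 2 by lra.
  have := ler_wpM2l Ce h3; rewrite mulrBr; move: h1 h2.
  set a1 := _ * ln _; set a2 := _ * ln _; set a3 := _ / _; set a4 := bigop _ _ _.
  lra.
have [N1 hN1] := ln_nat_unbounded (S / (e / 2)).
exists (maxn N N1) => t; rewrite geq_max => /andP[Nt N1t].
have t0 : 0 < t%:R :> R by rewrite ltr0n (leq_trans Np).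
rewrite mulrA ler_pdivlMr// mulrC mulrA divff ?gt_eqF// mul1r.
apply: (le_trans (hs _ Nt)).
by have := hN1 _ N1t; rewrite ler_pdivrMr//; lra.
Qed.

(** An asymptotic upper bound with every constant C + e yields a remainder
    function: the positive part of the excess over C f. *)
Lemma littleo_excess (u f : nat -> R) C :
  (forall t, 0 <= f t) ->
  (forall e, 0 < e -> exists N, forall t, (N <= t)%N -> u t <= (C + e) * f t) ->
  exists2 r : nat -> R, r =o_\oo f & forall t, u t <= C * f t + r t.
Proof.
move=> f0 H; exists (fun t => Num.max 0 (u t - C * f t)); last first.
  by move=> t; rewrite -lerBlDl le_max lexx orbT.
apply/eqoP => e e0; have [N hN] := H _ e0.
exists N => // t /= Nt.
rewrite !ger0_norm ?le_max ?lexx//.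
rewrite ge_max mulr_ge0 ?(ltW e0)//=.
by have := hN _ Nt; rewrite mulrDl; lra.
Qed.
End asymptotics.

(** * Random vectors and integrable functions *)

Section random_vectors.
Context {d : measure_display} {T : measurableType d} {R : realType} {n : nat}.
Implicit Types (X Y : T -> 'rV[R]_n).

Lemma random_vector_cst (c : 'rV[R]_n) : random_vector (fun _ : T => c).
Proof. by move=> i; exact: measurable_cst. Qed.

Lemma random_vectorD X Y : random_vector X -> random_vector Y ->
  random_vector (fun w => X w + Y w).
Proof.
move=> mX mY i; under eq_fun do rewrite mxE.
exact: (measurable_funD (mX i) (mY i)).
Qed.

Lemma random_vectorZ (a : R) X : random_vector X -> random_vector (fun w => a *: X w).
Proof.
move=> mX i; under eq_fun do rewrite mxE.
by apply: (measurable_funM _ (mX i)); exact: measurable_cst.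
Qed.

Lemma random_vectorB X Y : random_vector X -> random_vector Y ->
  random_vector (fun w => X w - Y w).
Proof.
move=> mX mY; have := random_vectorD mX (random_vectorZ (-1) mY).
by under eq_fun do rewrite scaleN1r.
Qed.

Lemma random_vector_lipschitz (f : 'rV[R]_n -> 'rV[R]_n) (L : R) X :
  elipschitz L f -> random_vector X -> random_vector (fun w => f (X w)).
Proof.
move=> fL mX i; apply: (@measurable_lipschitz_comp _ _ _ _ (fun x => f x 0 i) L) => //.
move=> x y; apply: le_trans (fL y x).
by have := normr_coord_le_enorm (f x - f y) i; rewrite !mxE.
Qed.

Lemma measurable_dotp X Y : random_vector X -> random_vector Y ->
  measurable_fun setT (fun w => dotp (X w) (Y w)).
Proof.
by move=> mX mY; apply: measurable_sum => i; exact: (measurable_funM (mX i) (mY i)).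
Qed.

End random_vectors.

Section integrable_functions.
Context {d : measure_display} {T : measurableType d} {R : realType}.
Variable P : probability T R.
Implicit Types f g : T -> R.

(** Integrability of a real-valued function. *)
Definition intg f := P.-integrable setT (EFin \o f).

Lemma intg_measurable f : intg f -> measurable_fun setT f.
Proof. by move=> /measurable_int/measurable_EFinP. Qed.

Lemma intg_cst (c : R) : intg (fun=> c).
Proof. exact: finite_measure_integrable_cst. Qed.

Lemma intgD f g : intg f -> intg g -> intg (fun w => f w + g w).
Proof.
move=> hf hg; have := integrableD measurableT hf hg.
by apply: eq_integrable.
Qed.

Lemma intgZ (a : R) f : intg f -> intg (fun w => a * f w).
Proof.
move=> hf; have := integrableZl measurableT a hf.
by apply: eq_integrable.
Qed.

Lemma intg_le f g : measurable_fun setT f -> (forall w, `|f w| <= g w) ->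
  intg g -> intg f.
Proof.
move=> mf fg hg; apply: (le_integrable measurableT _ _ hg).
  exact/measurable_EFinP.
by move=> w _; rewrite /= lee_fin (le_trans (fg w))// ler_norm.
Qed.

Lemma expectation_Rintegral f : intg f -> ('E_P[f] = (\int[P]_w f w)%:E)%E.
Proof.
by move=> hf; rewrite unlock /Rintegral fineK//; exact: integrable_fin_num.
Qed.

Lemma intg_of_expectation f : measurable_fun setT f -> (forall w, 0 <= f w) ->
  ('E_P[f] < +oo)%E -> intg f.
Proof.
move=> mf f0; rewrite unlock => hf; apply/integrableP; split.
  exact/measurable_EFinP.
by under eq_integral do rewrite /= ger0_norm//.
Qed.

Lemma Rintegral_lin f g (a b : R) : intg f -> intg g ->
  \int[P]_w (a * f w + b * g w) = a * \int[P]_w f w + b * \int[P]_w g w.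
Proof.
move=> hf hg; rewrite RintegralD//; last 2 first.
- exact: intgZ.
- exact: intgZ.
by rewrite !RintegralZl.
Qed.

Lemma intg_sum (I : Type) (r : seq I) (F : I -> T -> R) : (forall i, intg (F i)) ->
  intg (fun w => \sum_(i <- r) F i w).
Proof.
move=> hF; elim: r => [|i r IH].
  by under eq_fun do rewrite big_nil; exact: intg_cst.
by under eq_fun do rewrite big_cons; exact: intgD.
Qed.

Lemma Rintegral_sum (I : Type) (r : seq I) (F : I -> T -> R) : (forall i, intg (F i)) ->
  \int[P]_w (\sum_(i <- r) F i w) = \sum_(i <- r) \int[P]_w F i w.
Proof.
move=> hF; elim: r => [|i r IH].
  under eq_Rintegral do rewrite big_nil.
  by rewrite big_nil Rintegral_cst// mul0r.
under eq_Rintegral do rewrite big_cons.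
rewrite big_cons -IH RintegralD //; [exact: hF|exact: (intg_sum r hF)].
Qed.

Lemma le_Rintegral_ae_cst f (c : R) : intg f -> {ae P, forall w, f w <= c} ->
  \int[P]_w f w <= c.
Proof.
move=> hf fc.
have mm : measurable_fun setT (fun w => Num.max (f w) c).
  by apply: measurable_maxr; [exact: intg_measurable|exact: measurable_cst].
have im : intg (fun w => Num.max (f w) c).
  apply: (intg_le mm _ (intgD (integrable_norm hf) (intg_cst `|c|))) => w /=.
  by case: (leP (f w) c) => _; rewrite ?lerDl ?lerDr.
have -> : c = \int[P]_w (Num.max (f w) c).
  transitivity (\int[P]_(w in setT) (cst c w : R)).
    by rewrite Rintegral_cst // -[X in fine X]/(P setT) (probability_setT P) mulr1.
  rewrite /Rintegral; congr fine; apply: ae_eq_integral => //.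
  - exact/measurable_EFinP.
  - exact/measurable_EFinP.
  - case: fc => N [mN N0 sN]; exists N; split => //.
    apply: subset_trans sN => w /= h fw.
    by apply: h => _; rewrite max_r.
by apply: le_Rintegral => // w _; rewrite le_max lexx.
Qed.

End integrable_functions.

Section square_integrability.
Context {d : measure_display} {T : measurableType d} {R : realType} {n : nat}.
Variable P : probability T R.
Implicit Types (X Y : T -> 'rV[R]_n).

(** Square integrability, with a real-valued integrability condition in place of
    the finiteness of an extended expectation. *)
Definition sqint Y := random_vector Y /\ intg P (fun w => dotp (Y w) (Y w)).

Lemma square_integrable_sqint Y : square_integrable P Y -> sqint Y.
Proof.
move=> [mY hY]; split=> //; apply: intg_of_expectation.
- exact: measurable_dotp.
- by move=> w; exact: dotp_ge0.
- by under eq_fun do rewrite -enorm_sqr.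
Qed.

Lemma sqint_le Y (f : T -> R) : random_vector Y ->
  (forall w, dotp (Y w) (Y w) <= f w) -> intg P f -> sqint Y.
Proof.
move=> mY Yf hf; split=> //; apply: (intg_le _ _ hf) => [|w].
  exact: measurable_dotp.
by rewrite ger0_norm ?dotp_ge0.
Qed.

Lemma sqint_cst (c : 'rV[R]_n) : sqint (fun=> c).
Proof. by split; [exact: random_vector_cst|exact: intg_cst]. Qed.

Lemma sqintD X Y : sqint X -> sqint Y -> sqint (fun w => X w + Y w).
Proof.
move=> [mX hX] [mY hY]; apply: (sqint_le (random_vectorD mX mY)) => [w|].
  exact: dotp_le2D.
by apply: intgD; exact: intgZ.
Qed.

Lemma sqintZ (a : R) X : sqint X -> sqint (fun w => a *: X w).
Proof.
move=> [mX hX]; apply: (sqint_le (f := fun w => a ^+ 2 * dotp (X w) (X w))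
  (random_vectorZ a mX)) => [w|].
  by rewrite dotpZl dotpZr mulrA.
exact: intgZ.
Qed.

Lemma sqintB X Y : sqint X -> sqint Y -> sqint (fun w => X w - Y w).
Proof.
move=> hX hY; have := sqintD hX (sqintZ (-1) hY).
by under eq_fun do rewrite scaleN1r.
Qed.

Lemma sqint_lipschitz (f : 'rV[R]_n -> 'rV[R]_n) (L : R) X :
  elipschitz L f -> sqint X -> sqint (fun w => f (X w)).
Proof.
move=> fL hX; have [mX _] := hX.
suff h : sqint (fun w => f (X w) - f 0).
  have := sqintD h (sqint_cst (f 0)).
  by under eq_fun do rewrite subrK.
apply: (sqint_le (f := fun w => L ^+ 2 * dotp (X w) (X w))).
- apply: random_vectorB; last exact: random_vector_cst.
  exact: random_vector_lipschitz fL mX.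
- move=> w; rewrite -!enorm_sqr -exprMn; have := fL 0 (X w); rewrite subr0 => h.
  by rewrite lerXn2r ?nnegrE ?sqrtr_ge0// (le_trans _ h)// sqrtr_ge0.
- by apply: intgZ; case: hX.
Qed.

Lemma intg_dotp X Y : sqint X -> sqint Y -> intg P (fun w => dotp (X w) (Y w)).
Proof.
move=> hX hY; have [mX _] := hX; have [mY _] := hY.
apply: (intg_le (g := fun w => dotp (X w) (X w) + dotp (Y w) (Y w))).
- exact: measurable_dotp.
- move=> w; have := dotp_ge0 (X w + Y w); have := dotp_ge0 (X w - Y w).
  have := dotp_ge0 (X w); have := dotp_ge0 (Y w).
  rewrite !dotpE (dotpC (Y w)) ler_norml => *; apply/andP; split; lra.
- by apply: intgD; [case: hX|case: hY].
Qed.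

Lemma intg_coordM X Y i : sqint X -> sqint Y -> intg P (fun w => X w 0 i * Y w 0 i).
Proof.
move=> [mX hX] [mY hY].
apply: (intg_le (g := fun w => dotp (X w) (X w) + dotp (Y w) (Y w))).
- exact: (measurable_funM (mX i) (mY i)).
- move=> w; rewrite normrM.
  have h1 : `|X w 0 i| ^+ 2 <= dotp (X w) (X w).
    by rewrite -enorm_sqr lerXn2r ?nnegrE ?sqrtr_ge0// normr_coord_le_enorm.
  have h2 : `|Y w 0 i| ^+ 2 <= dotp (Y w) (Y w).
    by rewrite -enorm_sqr lerXn2r ?nnegrE ?sqrtr_ge0// normr_coord_le_enorm.
  have := sqr_ge0 (`|X w 0 i| - `|Y w 0 i|).
  have := sqr_ge0 (`|X w 0 i|); have := sqr_ge0 (`|Y w 0 i|); nra.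
- exact: intgD.
Qed.

Lemma sqint_sum (I : Type) (r : seq I) (Y : I -> T -> 'rV[R]_n) :
  (forall i, sqint (Y i)) -> sqint (fun w => \sum_(i <- r) Y i w).
Proof.
move=> hY; elim: r => [|i r IH].
  by under eq_fun do rewrite big_nil; exact: sqint_cst.
by under eq_fun do rewrite big_cons; exact: sqintD.
Qed.

End square_integrability.

(** * One step of the past extra-gradient method *)

(** The arithmetic of one step: D and D1 are the squared distances to the
    solution before and after it, dl and dl' the squared differences of
    consecutive oracle outputs, p + S the inner product of the output with
    X_{t+1/2} - x*, split into its mean part and its noise part, N and N' the
    squared norms of the noise; m, u and r are the squared distances from
    X_{t+1/2} to X_t, to x* and to X_{t-1/2}. *)
Lemma descent_arith {R : realType} (D D1 g g' p S dl dl' m u r N N' alpha beta2 : R) :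
  0 <= m -> 0 <= dl' -> 0 < g -> g <= 1 -> g <= g' -> 0 <= beta2 -> 0 < alpha ->
  4 * alpha * g <= 1 -> 24 * beta2 * g <= 1 ->
  D1 <= D - 2 * g * (p + S) + g ^+ 2 * dl - m ->
  alpha * u <= p -> D <= 2 * m + 2 * u ->
  dl <= 3 * (beta2 * r) + 3 * N + 3 * N' -> r <= 2 * m + 2 * (g' ^+ 2 * dl') ->
  D1 + g ^+ 3 * dl + 2 * g * S <=
    (1 - alpha * g) * (D + g' ^+ 3 * dl') + 3 * (g ^+ 2 + g ^+ 3) * (N + N').
Proof.
move=> m0 dl0 g0 g1 gg b0 a0 ag bg H1 H2 H3 H4 H5.
have k0 : 0 <= g ^+ 2 + g ^+ 3 by rewrite addr_ge0 ?exprn_ge0 ?ltW.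
have H45 : dl <= 6 * beta2 * m + 6 * beta2 * (g' ^+ 2 * dl') + 3 * (N + N').
  by have := ler_wpM2l b0 H5; lra.
have k1 := ler_wpM2l k0 H45.
have k2 : g * (alpha * (D - 2 * m)) <= 2 * g * p.
  have : alpha * (D - 2 * m) <= 2 * p by have := ler_wpM2l (ltW a0) H3; lra.
  by move=> h; have := ler_wpM2l (ltW g0) h; lra.
have gk : g ^+ 2 + g ^+ 3 <= 2 * g ^+ 2.
  have : g ^+ 2 * g <= g ^+ 2 * 1 by rewrite ler_wpM2l// exprn_ge0// ltW.
  by rewrite -exprSr; lra.
have bg2 : 12 * beta2 * g ^+ 2 <= g / 2.
  by have := ler_wpM2l (ltW g0) bg; rewrite expr2; lra.
have bk : 6 * beta2 * (g ^+ 2 + g ^+ 3) <= g / 2.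
  by have := ler_wpM2l b0 gk; lra.
have km := ler_wpM2r m0 bk.
have e0 : 0 <= g' ^+ 2 * dl' by rewrite mulr_ge0// exprn_ge0//; lra.
have ke := ler_wpM2r e0 bk.
have kg := ler_wpM2r e0 gg.
have kf : alpha * g * (g' * (g' ^+ 2 * dl')) <= (g' * (g' ^+ 2 * dl')) / 4.
  have e1 : 0 <= g' * (g' ^+ 2 * dl') by rewrite mulr_ge0//; lra.
  by have := ler_wpM2r e1 ag; lra.
have kam : alpha * g * m <= m / 4 by have := ler_wpM2r m0 ag; lra.
have kgm : g * m <= m by have := ler_wpM2r m0 g1; lra.
have -> : g' ^+ 3 * dl' = g' * (g' ^+ 2 * dl') by ring.
move: (g' ^+ 2 * dl') e0 ke kg kf k1 => z *.
have e2 : 0 <= g' * z by rewrite mulr_ge0//; lra.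
lra.
Qed.

Section stochastic_peg.
Context {R : realType} {n : nat}.
Context {disp : measure_display} {T : measurableType disp}.
Variables (P : probability T R) (K : set 'rV[R]_n).
Variable V : 'rV[R]_n -> 'rV[R]_n.
Variables (alpha beta sigma : R) (gam : nat -> R) (xstar : 'rV[R]_n).
Variables (X Xh Vh Z : nat -> T -> 'rV[R]_n).
Hypotheses (K0 : K !=set0) (Kcl : closed K).
Hypothesis Kcv : @convex_set R 'rV[R]_n K.
Hypothesis alpha_gt0 : 0 < alpha.
Hypothesis V_lipschitz : elipschitz beta V.
Hypothesis V_monotone : strongly_monotone alpha V.
Hypothesis xstar_sol : vi_solution K V xstar.
Hypothesis Xh0_sqint : square_integrable P (Xh 0%N).
Hypothesis X1_sqint : square_integrable P (X 1%N).
Hypothesis Xh0_in : forall w, K (Xh 0%N w).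
Hypothesis oracle : stochastic_oracle P sigma V X Xh Vh Z.
Hypothesis run : forall w, peg_run K gam (X ^~ w) (Xh ^~ w) (Vh ^~ w).

Let XhwE t w : (1 <= t)%N -> Xh t w = eproj K (X t w - gam t *: Vh t.-1 w).
Proof. by move=> t1; have [] := run w t1. Qed.

Let XSwE t w : (1 <= t)%N -> X t.+1 w = eproj K (X t w - gam t *: Vh t w).
Proof. by move=> t1; have [] := run w t1. Qed.

Let XhE t : (1 <= t)%N -> Xh t = fun w => eproj K (X t w - gam t *: Vh t.-1 w).
Proof. by move=> t1; apply/funext => w; exact: XhwE. Qed.

Let XSE t : (1 <= t)%N -> X t.+1 = fun w => eproj K (X t w - gam t *: Vh t w).
Proof. by move=> t1; apply/funext => w; exact: XSwE. Qed.

Let VhwE t w : Vh t w = V (Xh t w) + Z t w.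
Proof. by have [] := oracle t. Qed.

Let VhE t : Vh t = fun w => V (Xh t w) + Z t w.
Proof. by apply/funext => w; exact: VhwE. Qed.

Let eproj_lipschitz : elipschitz 1 (eproj K).
Proof. by move=> x y; rewrite mul1r ler_enorm; exact: eproj_nonexpansive. Qed.

Lemma Xh_in t w : K (Xh t w).
Proof. by case: t => // t; rewrite XhE//; exact: eproj_in. Qed.

Let sqZ t : sqint P (Z t).
Proof.
have [mZ _ _ [g [iZ _ _ _] _]] := oracle t; split=> //.
by under [X in intg _ X]eq_fun do rewrite -enorm_sqr.
Qed.

Let noise_var t : \int[P]_w dotp (Z t w) (Z t w) <= sigma ^+ 2.
Proof.
have [_ _ _ [g [iZ ig _ Eg] gs]] := oracle t.
have -> : \int[P]_w dotp (Z t w) (Z t w) = \int[P]_w g w.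
  under eq_Rintegral do rewrite -enorm_sqr.
  by rewrite /Rintegral Eg//; exact: (@measurableT _ (g_sigma_algebraType _)).
exact: le_Rintegral_ae_cst.
Qed.

Let sq_all t : sqint P (Xh t) /\ sqint P (X t.+1).
Proof.
elim: t => [|t [hXh hX]].
  by split; exact: square_integrable_sqint.
have hVh : sqint P (Vh t).
  by rewrite VhE; apply: sqintD => //; exact: sqint_lipschitz V_lipschitz hXh.
have hXh1 : sqint P (Xh t.+1).
  rewrite XhE//; apply: (sqint_lipschitz eproj_lipschitz).
  by apply: sqintB => //; exact: sqintZ.
split=> //; rewrite XSE//; apply: (sqint_lipschitz eproj_lipschitz).
apply: sqintB => //; apply: sqintZ.
by rewrite VhE; apply: sqintD => //; exact: sqint_lipschitz V_lipschitz hXh1.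
Qed.

Let sqXh t : sqint P (Xh t). Proof. exact: (sq_all t).1. Qed.

Let sqVh t : sqint P (Vh t).
Proof.
by rewrite VhE; apply: sqintD => //; exact: sqint_lipschitz V_lipschitz (sqXh t).
Qed.

Lemma sqint_X t : (1 <= t)%N -> sqint P (X t).
Proof. by case: t => // t _; exact: (sq_all t).2. Qed.

(** The generators of the history up to time t + 1/2. *)
Let gen (t : nat) : set (set T) := [set A | exists i : 'I_n,
        [\/ g_sigma_algebra_preimage (fun w => Xh 0%N w 0 i) A,
            g_sigma_algebra_preimage (fun w => X 1%N w 0 i) A |
            exists2 s, (s < t)%N &
              g_sigma_algebra_preimage (fun w => Vh s w 0 i) A]].

Let gen_measurable t : gen t `<=` measurable.
Proof.
move=> A [i [[B mB <-]|[B mB <-]|[s st [B mB <-]]]].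
- exact: ((sqXh 0).1 i measurableT B mB).
- exact: ((sqint_X (leqnn 1)).1 i measurableT B mB).
- exact: ((sqVh s).1 i measurableT B mB).
Qed.

(** Measurability of a vector with respect to the history. *)
Let adapted t (Y : T -> 'rV[R]_n) :=
  @random_vector _ (g_sigma_algebraType (gen t)) R n Y.

Let adaptedS t Y : adapted t Y -> adapted t.+1 Y.
Proof.
move=> aY i _ B mB; have := aY i measurableT B mB.
apply: sub_sigma_algebra2 => A [j [h|h|[s st h]]]; exists j.
- exact: Or31.
- exact: Or32.
- by apply: Or33; exists s => //; exact: ltnW.
Qed.

Let adapted_Vh t s : (s < t)%N -> adapted t (Vh s).
Proof.
move=> st i _ B mB; apply: sub_sigma_algebra; exists i; apply: Or33.
by exists s => //; exists B.
Qed.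

Let adapted_X t : adapted t.+1 (X t.+1).
Proof.
elim: t => [|t IH].
  by move=> i _ B mB; apply: sub_sigma_algebra; exists i; apply: Or32; exists B.
rewrite XSE//; apply: (random_vector_lipschitz eproj_lipschitz).
apply: random_vectorB; first exact: adaptedS.
by apply: random_vectorZ; exact: adapted_Vh.
Qed.

Let adapted_Xh t : adapted t (Xh t).
Proof.
case: t => [|t].
  by move=> i _ B mB; apply: sub_sigma_algebra; exists i; apply: Or31; exists B.
rewrite XhE//; apply: (random_vector_lipschitz eproj_lipschitz).
apply: random_vectorB; first exact: adapted_X.
by apply: random_vectorZ; exact: adapted_Vh.
Qed.

(** The iterate X_{t+1/2} is determined by the history, given which the noise
    has mean zero. *)
Let noise_orthogonal t : \int[P]_w dotp (Z t w) (Xh t w - xstar) = 0.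
Proof.
have sqY : sqint P (fun w => Xh t w - xstar).
  by apply: sqintB => //; exact: sqint_cst.
have [_ _ hZ _] := oracle t.
rewrite /dotp Rintegral_sum; last by move=> i; exact: (intg_coordM i (sqZ t) sqY).
apply: big1 => i _; have [iZ _ _ EZ] := hZ i.
under eq_Rintegral do rewrite mulrC.
rewrite /Rintegral (@pull_out _ _ _ P (gen t) (@gen_measurable t)
  (fun w => Z t w 0 i)) //.
- by move=> A FA; rewrite EZ// integral0.
- have : adapted t (fun w => Xh t w - xstar).
    by apply: random_vectorB; [exact: adapted_Xh|exact: random_vector_cst].
  exact.
- exact: (intg_coordM i sqY (sqZ t)).
Qed.

(* D, dl and N are the squared distance to the solution, the squared difference
   of consecutive oracle outputs and the squared norm of the noise; S is the
   noise part of the inner product of the output with X_{t+1/2} - x*. *)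
Let D t w := dotp (X t w - xstar) (X t w - xstar).
Let dl t w := dotp (Vh t w - Vh t.-1 w) (Vh t w - Vh t.-1 w).
Let N t w := dotp (Z t w) (Z t w).
Let S t w := dotp (Z t w) (Xh t w - xstar).

Let pointwise_descent t w : (2 <= t)%N -> 0 < gam t -> gam t <= 1 ->
  gam t <= gam t.-1 -> 4 * alpha * gam t <= 1 -> 24 * beta ^+ 2 * gam t <= 1 ->
  D t.+1 w + gam t ^+ 3 * dl t w + 2 * gam t * S t w <=
    (1 - alpha * gam t) * (D t w + gam t.-1 ^+ 3 * dl t.-1 w)
    + 3 * (gam t ^+ 2 + gam t ^+ 3) * (N t w + N t.-1 w).
Proof.
move=> t2 g0 g1 gg ag bg; have t1 : (1 <= t)%N by exact: ltnW.
have t1' : (1 <= t.-1)%N by case: t t2 {t1 g0 g1 gg ag bg} => [|[]].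
have [Kx xopt] := xstar_sol.
apply: (@descent_arith _ _ _ _ _ (dotp (V (Xh t w)) (Xh t w - xstar)) _ _ _
  (dotp (Xh t w - X t w) (Xh t w - X t w))
  (dotp (Xh t w - xstar) (Xh t w - xstar))
  (dotp (Xh t w - Xh t.-1 w) (Xh t w - Xh t.-1 w)) _ _ alpha (beta ^+ 2)) => //.
- exact: dotp_ge0.
- exact: dotp_ge0.
- exact: sqr_ge0.
- have := extragradient_step K0 Kcl Kcv (X t w) (Vh t.-1 w) (Vh t w) (gam t) Kx.
  rewrite /= -XhwE// -XSwE//.
  suff -> : dotp (Vh t w) (Xh t w - xstar) =
    dotp (V (Xh t w)) (Xh t w - xstar) + S t w by exact.
  by rewrite VhwE dotpDl.
- have := V_monotone xstar (Xh t w); rewrite enorm_sqr => /le_trans; apply.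
  by rewrite dotpDl dotpNl gerBl; exact/xopt/Xh_in.
- rewrite /D; have -> : X t w - xstar = (Xh t w - xstar) - (Xh t w - X t w).
    by apply/rowP => i; rewrite !mxE; ring.
  by rewrite [leRHS]addrC; apply: dotp_le2B.
- rewrite /dl /N.
  have -> : Vh t w - Vh t.-1 w = (V (Xh t w) - V (Xh t.-1 w)) + Z t w - Z t.-1 w.
    by rewrite !VhwE; apply/rowP => i; rewrite !mxE; ring.
  apply: (le_trans (dotp_le3 _ _ _)); rewrite !lerD2r ler_pM2l//.
  have := V_lipschitz (Xh t.-1 w) (Xh t w).
  rewrite -!enorm_sqr -exprMn => h.
  by rewrite lerXn2r ?nnegrE ?sqrtr_ge0// (le_trans _ h)// sqrtr_ge0.
- have -> : Xh t w - Xh t.-1 w = (Xh t w - X t w) + (X t w - Xh t.-1 w).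
    by apply/rowP => i; rewrite !mxE; ring.
  apply: (le_trans (dotp_le2D _ _)); rewrite lerD2l ler_pM2l//.
  have -> : X t w = eproj K (X t.-1 w - gam t.-1 *: Vh t.-1 w).
    by rewrite -[in LHS](prednK t1) XSwE.
  have -> : Xh t.-1 w = eproj K (X t.-1 w - gam t.-1 *: Vh t.-1.-1 w) by rewrite XhwE.
  apply: (le_trans (eproj_nonexpansive K0 Kcl Kcv _ _)).
  have -> : X t.-1 w - gam t.-1 *: Vh t.-1 w - (X t.-1 w - gam t.-1 *: Vh t.-1.-1 w)
     = (- gam t.-1) *: (Vh t.-1 w - Vh t.-1.-1 w).
    by apply/rowP => i; rewrite !mxE; ring.
  by rewrite dotpZl dotpZr mulrA mulrNN -expr2.
Qed.

(** The mean of the Lyapunov function. *)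
Let EL t := \int[P]_w (D t w + gam t.-1 ^+ 3 * dl t.-1 w).

Let intD t : (1 <= t)%N -> intg P (D t).
Proof. by move=> /sqint_X hX; have [] := sqintB hX (sqint_cst P xstar). Qed.

Let intdl t : intg P (dl t).
Proof. by have [] := sqintB (sqVh t) (sqVh t.-1). Qed.

Let intN t : intg P (N t). Proof. by have [] := sqZ t. Qed.

Let intS t : intg P (S t).
Proof. by apply: intg_dotp => //; apply: sqintB => //; exact: sqint_cst. Qed.

(** The recursion for the mean of the Lyapunov function
    D_t + g_{t-1}^3 delta_{t-1}; the noise enters through its variance only. *)
Lemma mean_descent t : (2 <= t)%N -> 0 < gam t -> gam t <= 1 ->
  gam t <= gam t.-1 -> 4 * alpha * gam t <= 1 -> 24 * beta ^+ 2 * gam t <= 1 ->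
  EL t.+1 <= (1 - alpha * gam t) * EL t + 6 * sigma ^+ 2 * (gam t ^+ 2 + gam t ^+ 3).
Proof.
move=> t2 g0 g1 gg ag bg; have t1 : (1 <= t)%N by exact: ltnW.
have i1 s c u : (1 <= s)%N -> intg P (fun w => D s w + c * dl u w).
  by move=> s1; apply: intgD; [exact: intD|exact: intgZ].
have i2 : intg P (fun w => 1 * N t w + 1 * N t.-1 w).
  by apply: intgD; exact: intgZ.
have H : \int[P]_w (1 * (D t.+1 w + gam t ^+ 3 * dl t w) + 2 * gam t * S t w) <=
  \int[P]_w ((1 - alpha * gam t) * (D t w + gam t.-1 ^+ 3 * dl t.-1 w)
    + 3 * (gam t ^+ 2 + gam t ^+ 3) * (1 * N t w + 1 * N t.-1 w)).
  apply: le_Rintegral => //.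
  - by apply: intgD; apply: intgZ => //; exact: i1.
  - by apply: intgD; apply: intgZ => //; exact: i1.
  - by move=> w _; rewrite !mul1r; exact: pointwise_descent.
move: H; rewrite !Rintegral_lin//; try exact: i1.
rewrite noise_orthogonal -/(EL t) -/(EL t.+1) !mul1r mulr0 addr0 => /le_trans; apply.
have k0 : 0 <= 3 * (gam t ^+ 2 + gam t ^+ 3).
  by rewrite mulr_ge0// addr_ge0// exprn_ge0// ltW.
have := ler_wpM2l k0 (lerD (noise_var t) (noise_var t.-1)); rewrite /N; lra.
Qed.

Lemma mean_le_lyapunov t : (1 <= t)%N -> 0 <= gam t.-1 ->
  \int[P]_w dotp (X t w - xstar) (X t w - xstar) <= EL t.
Proof.
move=> t1 g0; apply: le_Rintegral => //.
- exact: intD.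
- by apply: intgD; [exact: intD|exact: intgZ].
- by move=> w _; rewrite lerDl mulr_ge0 ?dotp_ge0// exprn_ge0.
Qed.

End stochastic_peg.

(** * Ergodic averages and the convergence rates *)

Section ergodic.
Context {d : measure_display} {T : measurableType d} {R : realType} {n : nat}.
Variables (P : probability T R) (X : nat -> T -> 'rV[R]_n) (x : 'rV[R]_n).
Hypothesis hX : forall t, (1 <= t)%N -> sqint P (X t).

Lemma sqint_ergodic_average t : sqint P (ergodic_average X t).
Proof.
apply: sqintZ; under eq_fun do rewrite big_add1 /=.
by apply: sqint_sum => i; exact: hX.
Qed.

Lemma mean_ergodic_average t : (0 < t)%N ->
  \int[P]_w dotp (ergodic_average X t w - x) (ergodic_average X t w - x) <=
  t%:R^-1 * \sum_(1 <= s < t.+1) \int[P]_w dotp (X s w - x) (X s w - x).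
Proof.
move=> t0.
have iX s : intg P (fun w => dotp (X s.+1 w - x) (X s.+1 w - x)).
  by have [] := sqintB (hX (ltn0Sn s)) (sqint_cst P x).
have iS : intg P (fun w => \sum_(0 <= s < t) dotp (X s.+1 w - x) (X s.+1 w - x)).
  exact: intg_sum.
rewrite big_add1 /= -Rintegral_sum// -RintegralZl//.
apply: le_Rintegral => //.
- by have [] := sqintB (sqint_ergodic_average t) (sqint_cst P x).
- exact: intgZ.
- move=> w _; rewrite -enorm_sqr.
  apply: (le_trans (enorm_ergodic_average X w x t0)); rewrite big_add1 /=.
  by under eq_bigr do rewrite enorm_sqr.
Qed.

End ergodic.

Theorem theorem5 (R : realType) (d : nat)
  (K : set 'rV[R]_d) (V : 'rV[R]_d -> 'rV[R]_d)
  (alpha beta gamma b sigma : R) (xstar : 'rV[R]_d)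
  (disp : measure_display) (T : measurableType disp) (P : probability T R)
  (X Xh Vh Z : nat -> T -> 'rV[R]_d)
  (K_nonempty : K !=set0) (K_closed : closed K)
  (K_convex : @convex_set R 'rV[R]_d K)
  (alpha_gt0 : 0 < alpha) (beta_gt0 : 0 < beta) (sigma_ge0 : 0 <= sigma)
  (V_lipschitz : elipschitz beta V)
  (V_monotone : strongly_monotone alpha V)
  (xstar_sol : vi_solution K V xstar)
  (gamma_gt : 1 / alpha < gamma) (b_ge : 4 * beta * gamma <= b)
  (Xh0_sqint : square_integrable P (Xh 0%N))
  (X1_sqint : square_integrable P (X 1%N))
  (Xh0_in : forall w, K (Xh 0%N w)) (X1_in : forall w, K (X 1%N w))
  (oracle : stochastic_oracle P sigma V X Xh Vh Z)
  (run : forall w, peg_run K (fun t => gamma / (t%:R + b))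
                     (X ^~ w) (Xh ^~ w) (Vh ^~ w)) :
  let C := 6 * gamma ^+ 2 * sigma ^+ 2 / (alpha * gamma - 1) in
  (exists2 r : nat -> R, r =o_\oo (fun t : nat => 1 / t%:R : R) &
     forall t, (1 <= t)%N ->
       ('E_P[fun w => (enorm (X t w - xstar) ^+ 2)%R]
         <= (C * (1 / t%:R) + r t)%:E)%E) /\
  (exists2 r : nat -> R, r =o_\oo (fun t : nat => ln t%:R / t%:R : R) &
     forall t, (1 <= t)%N ->
       ('E_P[fun w => (enorm (ergodic_average X t w - xstar) ^+ 2)%R]
         <= (C * (ln t%:R / t%:R) + r t)%:E)%E).
Proof.
move=> C.
have gamma_gt0 : 0 < gamma by apply: lt_trans gamma_gt; rewrite divr_gt0.
have b0 : 0 < b by apply: lt_le_trans b_ge; rewrite !mulr_gt0.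
have q1 : 1 < alpha * gamma by rewrite ltr_pdivrMr// mulrC in gamma_gt.
pose gam t : R := gamma / (t%:R + b).
have sb0 t : 0 < t%:R + b by rewrite ltr_wpDl.
have gam0 t : 0 < gam t by exact: divr_gt0.
have gamS t : (1 <= t)%N -> gam t <= gam t.-1.
  move=> t1; rewrite ler_pM2l// lef_pV2 ?posrE// lerD2r ler_nat.
  exact: leq_pred.
(* The inequality M g_t <= 1 implies all the smallness conditions on g_t. *)
pose M := 1 + 4 * alpha + 24 * beta ^+ 2.
have M0 : 0 < M by rewrite /M addr_gt0 ?addr_gt0 ?mulr_gt0 ?exprn_gt0.
pose T0 := maxn 2 (Num.bound (gamma * M)).
have gamM t : (T0 <= t)%N -> M * gam t <= 1.
  rewrite geq_max => /andP[_ tT].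
  have gM0 : 0 <= gamma * M by rewrite mulr_ge0 ?ltW.
  rewrite mulrA ler_pdivrMr// mul1r mulrC (le_trans (ltW (archi_boundP gM0)))//.
  by apply: ler_wpDr; [exact: ltW|rewrite ler_nat].
have hX := sqint_X K_nonempty K_closed K_convex V_lipschitz Xh0_sqint X1_sqint oracle run.
pose u t := \int[P]_w dotp (X t w - xstar) (X t w - xstar).
(* For t <= 1 the predecessors are truncated and the last term has no meaning;
   the recursion starts at T0 >= 2. *)
pose EL t := \int[P]_w (dotp (X t w - xstar) (X t w - xstar) +
  gam t.-1 ^+ 3 * dotp (Vh t.-1 w - Vh t.-1.-1 w) (Vh t.-1 w - Vh t.-1.-1 w)).
have hEL t : (T0 <= t)%N -> EL t.+1 <= (1 - alpha * gamma / (t%:R + b)) * EL t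
   + 6 * gamma ^+ 2 * sigma ^+ 2 / (t%:R + b) ^+ 2
   + 6 * gamma ^+ 3 * sigma ^+ 2 / (t%:R + b) ^+ 3.
  move=> tT; have t2 : (2 <= t)%N by apply: leq_trans tT; exact: leq_maxl.
  have := gamM _ tT; have g0 := gam0 t; rewrite /M !mulrDl mul1r => gM.
  have ag : 0 < 4 * alpha * gam t by apply: mulr_gt0 => //; exact: mulr_gt0.
  have bg : 0 < 24 * beta ^+ 2 * gam t by apply: mulr_gt0 => //; rewrite mulr_gt0 ?exprn_gt0.
  have := @mean_descent _ _ _ _ P K V alpha beta sigma gam xstar X Xh Vh Z
    K_nonempty K_closed K_convex alpha_gt0 V_lipschitz V_monotone xstar_sol
    Xh0_sqint X1_sqint Xh0_in oracle run t t2 g0.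
  move=> h; apply: (le_trans (h _ (gamS _ (ltnW t2)) _ _)); [lra|lra|lra|].
  rewrite -/(EL t) le_eqVlt; apply/orP; left; apply/eqP.
  by rewrite /gam; field; rewrite gt_eqF.
have A0 : 0 <= 6 * gamma ^+ 2 * sigma ^+ 2.
  by apply: mulr_ge0; rewrite ?sqr_ge0// mulr_ge0 ?sqr_ge0.
have B0 : 0 <= 6 * gamma ^+ 3 * sigma ^+ 2.
  by apply: mulr_ge0; rewrite ?sqr_ge0// mulr_ge0// exprn_ge0// ltW.
have hu e : 0 < e -> exists N, forall t, (N <= t)%N -> u t <= (C + e) / t%:R.
  move=> e0; have [N hN] := chung q1 (ltW b0) A0 B0 hEL e0.
  exists (maxn 1 N) => t; rewrite geq_max => /andP[t1 /hN]; apply: le_trans.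
  have := @mean_le_lyapunov _ _ _ _ P K V beta sigma gam xstar X Xh Vh Z
    K_nonempty K_closed K_convex V_lipschitz
    Xh0_sqint X1_sqint oracle run t t1 (ltW (gam0 _)).
  exact.
have C0 : 0 <= C by rewrite divr_ge0// subr_ge0 ltW.
have Eu (Y : T -> 'rV[R]_d) : sqint P Y ->
    ('E_P[fun w => (enorm (Y w - xstar) ^+ 2)%R] =
    (\int[P]_w dotp (Y w - xstar) (Y w - xstar))%:E)%E.
  move=> hY; under eq_fun do rewrite enorm_sqr.
  by apply: expectation_Rintegral; have [] := sqintB hY (sqint_cst P xstar).
split.
- have f0 t : 0 <= 1 / t%:R :> R by rewrite divr_ge0.
  have fe e : 0 < e -> exists N, forall t, (N <= t)%N -> u t <= (C + e) * (1 / t%:R).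
    by move=> /hu[N hN]; exists N => t /hN; rewrite div1r.
  have [r ro hr] := littleo_excess f0 fe.
  by exists r => // t t1; rewrite (Eu _ (hX _ t1)) lee_fin; exact: hr.
- have f0 t : 0 <= ln t%:R / t%:R :> R.
    by case: t => [|t]; rewrite ?invr0 ?mulr0// divr_ge0// ln_ge0// ler1n.
  have [r ro hr] := littleo_excess f0 (ergodic_sum C0 hu).
  exists r => // t t1; rewrite Eu; last exact: sqint_ergodic_average.
  by rewrite lee_fin; apply: le_trans (hr t); exact: mean_ergodic_average.
Qed.
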